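(* Let $p\geq 2$ be an integer and let $\overline{\eta(\mathcal{T}_p)}$ be the closure of $\eta(\mathcal{T}_p)$ in $\mathbb{R}$. Then $$\overline{\eta(\mathcal{T}_p)}=\eta(\mathcal{T}_p)\;\cup\;\{\zeta^\star(k_1,\dots,k_r)\;:\;r\geq 1,\ k_i\in\mathbb{N},\ k_i\geq p\text{ for }1\leq i\leq r\}\;\cup\;\{1\},$$ and moreover: (i) $\overline{\eta(\mathcal{T}_p)}+\overline{\eta(\mathcal{T}_p)}$ is not a closed interval. (ii) $\overline{\eta(\mathcal{T}_p)}\cdot\overline{\eta(\mathcal{T}_p)}$ is not a closed interval.
   Context: $\mathbb{N}=\{1,2,3,\dots\}$. For positive integers $k_1,\dots,k_r$ with $k_1\geq 2$, the multiple zeta-star value is $$\zeta^\star(k_1,\dots,k_r)=\sum_{n_1\geq n_2\geq\cdots\geq n_r\geq 1}\frac{1}{n_1^{k_1}\cdots n_r^{k_r}}.$$ Let $\mathcal{T}$ be the set of all infinite sequences $(k_1,k_2,\dots,k_r,\dots)$ of positive integers such that $k_1\geq 2$ and, if $k_1=2$, then $k_s\geq 2$ for some $s\geq 2$. The map $\eta:\mathcal{T}\to(1,+\infty)$ is defined by $$\eta\big((k_1,k_2,\dots)\big)=\lim_{r\to+\infty}\zeta^\star(k_1,\dots,k_r).$$ For an integer $p\geq 2$, $$\mathcal{T}_p=\{(k_1,k_2,\dots)\in\mathcal{T}\;:\;k_i\geq p\text{ for all }i\geq 1\}.$$ For sets $A,B\subseteq\mathbb{R}$: $A+B=\{a+b: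 a\in A,b\in B\}$ and $A\cdot B=\{ab: a\in A,b\in B\}$. *)

(* Defs.v *)
From mathcomp Require Import all_boot all_order all_algebra.
From mathcomp Require Import all_classical all_reals all_analysis.

Set Implicit Arguments.
Unset Strict Implicit.
Unset Printing Implicit Defensive.

Import Order.TTheory GRing.Theory Num.Theory.
Import numFieldNormedType.Exports.

Local Open Scope classical_set_scope.
Local Open Scope ring_scope.

(* Positions are counted from 0: a finite index (k_1, ..., k_r) is a list and
   an infinite one is a function nat -> nat, and k_(i+1) is stored at i. *)

(* The tuples (n_1, ..., n_r) with n_1 >= ... >= n_r >= 1. *)
Definition star_domain (r : nat) : set (seq nat) :=
  [set n | [/\ size n = r, sorted geq n & all (leq 1) n]].

(* The sum of the nonnegative terms is taken in \bar R; [fine] returns 0 if it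
   diverges, which happens for nonempty k with positive entries only when
   k_1 = 1. *)
Definition zeta_star (R : realType) (k : seq nat) : R :=
  fine (\esum_(n in star_domain (size k))
    (\prod_(i < size k) ((nth 0%N n i)%:R ^+ nth 0%N k i)^-1)%:E).

Definition calT : set (nat -> nat) :=
  [set k | [/\ (forall i, 1 <= k i)%N, (2 <= k 0)%N &
               k 0%N = 2%N -> exists2 s, (1 <= s)%N & (2 <= k s)%N]].

(* Only meaningful on calT, where the sequence converges. *)
Definition eta (R : realType) (k : nat -> nat) : R :=
  limn (fun r => zeta_star R (mkseq k r)).

Definition calT_ge (p : nat) : set (nat -> nat) :=
  [set k | calT k /\ (forall i, p <= k i)%N].

Definition finite_values (R : realType) (p : nat) : set R :=
  [set zeta_star R k | k in [set k : seq nat | (1 <= size k)%N /\ all (leq p) k]].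
Arguments finite_values : clear implicits.

Definition sumset (R : realType) (A B : set R) : set R :=
  [set a + b | a in A & b in B].

Definition prodset (R : realType) (A B : set R) : set R :=
  [set a * b | a in A & b in B].

Definition is_closed_interval (R : realType) (A : set R) : Prop :=
  exists a b : R, A = `[a, b]%classic.

(* Main.v *)
Require Import Defs.
From mathcomp Require Import all_boot all_order all_algebra.
From mathcomp Require Import all_classical all_reals all_analysis.
From mathcomp Require Import zify ring lra.
Import Order.TTheory GRing.Theory Num.Theory.
Import numFieldNormedType.Exports.
Local Open Scope classical_set_scope.
Local Open Scope ring_scope.

(** Closure.  A zeta-star value is the limit of the truncated sums
    [tsum k ones N] over N >= n_1 >= ... >= n_r >= 1.  Appending a nonempty tail
    starting with a to a word w changes the value by a small nonnegative amount:
    the innermost factor 1 becomes 1 + O(2^-a), and only at n_r >= 2, while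
    forcing all n_i >= 2 costs a factor zeta(2) - 1 <= 13/20 per entry.  So the change is at most
    (13/20)^|w| * 4 / 2^a ([zeta_star_cat_le]), which is small when w is long,
    and also when a is large.  Hence the words over {p, p+1, ...} form a tree
    whose cylinders shrink, and whose children converge to the value of the
    parent word.  A point x of the closure lies in the closure of the root
    cylinder; in the closure of a cylinder it is either the value of that word
    or in the closure of a child.  If x is no finite value (the empty word
    having value 1), this produces an infinite branch, whose value is x.
    Conversely w followed by a, a, a, ... has values tending to that of w.

    Gap.  Put A = eta(p+1,p,p,...), B = zeta(p), M = eta(p,p,...).  As eta is
    antitone in the entries, the closure K lies in [1,A] U [B,M], and it contains
    1, A, B, M.  Comparing terms, A + M <= 2B follows from
    P_n (1 + 1/n) <= 2, where P_n is the product of 1/(1 - m^-p) over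
    2 <= m <= n; for p = 2 this is an equality since then P_n = 2n/(n+1), and
    for larger p it is strict at n = 2.  A sum of two points of K is at most
    A + M or at least 2B, so for p >= 3 the interval (A + M, 2B) is a gap of
    K + K.  A product is at most A M or at least B^2, and A M < B^2 for every
    p >= 2 because A + M <= 2B and B < M.  For p = 2 the sum set has the other
    gap (2A, 1 + B): A <= 2B - 2 by telescoping, and zeta(2) < 5/3. *)

(** * Truncated sums *)

(** Carrying an arbitrary function of the innermost variable makes [tsum k] a
    monotone linear operator, and concatenation of words its composition; a tail
    can then be replaced by a bound for it. *)
Fixpoint tsum {R : realType} (k : seq nat) (g : nat -> R) (N : nat) : R :=
  if k is a :: k' then \sum_(1 <= n < N.+1) n%:R ^- a * tsum k' g n else g N.

Local Notation ones := (fun=> 1).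

Lemma expV_ge0 {R : realType} (n a : nat) : 0 <= n%:R ^- a :> R.
Proof. by rewrite invr_ge0 exprn_ge0. Qed.

Lemma expV_anti {R : realType} (n a b : nat) :
  (a <= b)%N -> n.+1%:R ^- b <= n.+1%:R ^- a :> R.
Proof. by move=> ab; rewrite lef_pV2 ?posrE ?exprn_gt0// ler_weXn2l// ler1n. Qed.

Lemma tsum_cat {R : realType} (w v : seq nat) (g : nat -> R) N :
  tsum (w ++ v) g N = tsum w (tsum v g) N.
Proof. by elim: w N => //= a w IH N; apply: eq_bigr => n _; rewrite IH. Qed.

Lemma tsum_ge0 {R : realType} (w : seq nat) (g : nat -> R) N :
  (forall n, 0 <= g n) -> 0 <= tsum w g N.
Proof.
move=> g0; elim: w N => //= a w IH N; apply: sumr_ge0 => n _.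
by rewrite mulr_ge0 ?expV_ge0.
Qed.

Lemma tsum_le {R : realType} (w : seq nat) (g h : nat -> R) N :
  (forall n, g n.+1 <= h n.+1) -> tsum w g N.+1 <= tsum w h N.+1.
Proof.
move=> gh; elim: w N => //= a w IH N; apply: ler_sum_nat => -[//|n] _.
by rewrite ler_wpM2l ?expV_ge0.
Qed.

Lemma tsum_antitone {R : realType} (k l : seq nat) (g : nat -> R) N :
  (forall n, 0 <= g n) -> all2 leq l k -> tsum k g N <= tsum l g N.
Proof.
move=> g0; elim: k l N => [|a k IH] [|b l]//= N /andP[ba lk].
apply: ler_sum_nat => -[//|n] _.
by apply: ler_pM; rewrite ?expV_ge0 ?tsum_ge0 ?expV_anti// IH.
Qed.

Lemma tsumD {R : realType} (w : seq nat) (g h : nat -> R) N :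
  tsum w (fun n => g n + h n) N = tsum w g N + tsum w h N.
Proof.
elim: w N => //= a w IH N; rewrite -big_split/=; apply: eq_bigr => n _.
by rewrite IH mulrDr.
Qed.

Lemma tsumZ {R : realType} (w : seq nat) (c : R) (g : nat -> R) N :
  tsum w (fun n => c * g n) N = c * tsum w g N.
Proof.
elim: w N => //= a w IH N; rewrite mulr_sumr; apply: eq_bigr => n _.
by rewrite IH mulrCA.
Qed.

Lemma tsum_at1 {R : realType} (w : seq nat) (g : nat -> R) : tsum w g 1 = g 1%N.
Proof. by elim: w => //= a w IH; rewrite big_nat1 expr1n invr1 mul1r IH. Qed.

Lemma tsum_cons_recr {R : realType} a (w : seq nat) (g : nat -> R) N :
  tsum (a :: w) g N.+1 = tsum (a :: w) g N + N.+1%:R ^- a * tsum w g N.+1.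
Proof. by rewrite /= big_nat_recr. Qed.

Lemma tsum_nondecreasing {R : realType} (w : seq nat) :
  {homo tsum w ones : n m / (n <= m)%N >-> n <= m :> R}.
Proof.
apply/nondecreasing_seqP => N; case: w => [//|a w].
by rewrite tsum_cons_recr lerDl mulr_ge0 ?expV_ge0 ?tsum_ge0.
Qed.

(** The product of 1/(1 - m^-2) over 2 <= m <= n, in closed form.  It is the limit
    of [tsum [:: 2; ...; 2] ones n] as the word grows, hence the fixed point
    equation [sum_prodstar] and the bound [tsum_le_prodstar]. *)
Definition prodstar {R : realType} (n : nat) : R := 2 * n%:R / n.+1%:R.

Lemma sum_prodstar {R : realType} N :
  \sum_(1 <= n < N.+1) n%:R ^- 2 * prodstar n = prodstar N :> R.
Proof.
elim: N => [|N IH]; first by rewrite big_geq// /prodstar mulr0 mul0r.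
rewrite big_nat_recr//= IH /prodstar.
rewrite -(natr1 N.+1) -(natr1 N).
have : 0 <= N%:R :> R by []; move: N%:R => x x0.
by field; do ?[apply/andP; split]; apply: lt0r_neq0; lra.
Qed.

Lemma tsum_le_prodstar {R : realType} (w : seq nat) N :
  all (leq 2) w -> tsum w ones N.+1 <= prodstar N.+1 :> R.
Proof.
elim: w N => [|a w IH] N /=.
  by move=> _; rewrite /prodstar ler_pdivlMr// mul1r -natrM ler_nat; lia.
move=> /andP[a2 w2]; rewrite -sum_prodstar; apply: ler_sum_nat => -[//|n] _.
by apply: ler_pM; rewrite ?expV_ge0 ?tsum_ge0 ?expV_anti ?IH.
Qed.

Lemma prodstar_le2 {R : realType} N : prodstar N <= 2 :> R.
Proof. by rewrite /prodstar ler_pdivrMr// -!natrM ler_nat; lia. Qed.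

Lemma tsum_le2 {R : realType} (w : seq nat) N :
  all (leq 2) w -> tsum w ones N <= 2 :> R.
Proof.
move=> w2; apply: (@le_trans _ _ (tsum w ones N.+1)).
  exact: tsum_nondecreasing.
by apply: le_trans (prodstar_le2 N.+1); exact: tsum_le_prodstar.
Qed.

(** From the third term on, n^-2 is below the telescoping difference
    1/(n - 1/2) - 1/(n + 1/2). *)
Lemma sum_inv_sqr_le {R : realType} N :
  \sum_(1 <= n < N.+1) n%:R ^- 2 <= 33 / 20 :> R.
Proof.
suff H M : \sum_(1 <= n < M.+3) n%:R ^- 2 <= 33 / 20 - 2 / (2 * M.+2%:R + 1) :> R.
  apply: (@le_trans _ _ (\sum_(1 <= n < N.+3) n%:R ^- 2)).
    by rewrite (@big_nat_recr _ _ _ N.+2)// (@big_nat_recr _ _ _ N.+1)//=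
      -addrA lerDl addr_ge0 ?expV_ge0.
  by apply: (le_trans (H N)); rewrite gerBl divr_ge0// addr_ge0.
elim: M => [|M IH].
  rewrite big_ltn// big_nat1 expr1n le_eqVlt; apply/orP; left; apply/eqP.
  by field.
rewrite big_nat_recr//=; apply: (le_trans (lerD IH (lexx _))).
rewrite -lerBrDr -subr_ge0 -(natr1 M.+2) -(natr1 M.+1) -(natr1 M).
have : 0 <= M%:R :> R by []; move: M%:R => x x0 {IH}.
suff -> : 33 / 20 - 2 / (2 * (x + 1 + 1 + 1) + 1) - (x + 1 + 1 + 1) ^- 2
   - (33 / 20 - 2 / (2 * (x + 1 + 1) + 1)) =
   (4 * (x + 3) ^+ 2 - (2 * x + 7) * (2 * x + 5)) /
     ((2 * x + 7) * (2 * x + 5) * (x + 3) ^+ 2).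
  by rewrite divr_ge0// ?mulr_ge0 ?exprn_ge0//; nra.
by field; do ?[apply/andP; split]; apply: lt0r_neq0; lra.
Qed.

Definition ge2_indic {R : realType} (n : nat) : R := if (2 <= n)%N then 1 else 0.

(** The indicator forces every variable to be at least 2, so each entry contributes
    a factor at most zeta(2) - 1. *)
Lemma tsum_ge2_indic_le {R : realType} (w : seq nat) N :
  all (leq 2) w -> tsum w ge2_indic N <= (13 / 20) ^+ size w :> R.
Proof.
elim: w N => [|a w IH] N /=; first by rewrite /ge2_indic; case: ifP.
move=> /andP[a2 w2].
have w0 n : 0 <= tsum w ge2_indic n :> R.
  by apply: tsum_ge0 => m; rewrite /ge2_indic; case: ifP.
case: N => [|N]; first by rewrite big_geq// exprn_ge0//; lra.
rewrite big_ltn// tsum_at1 mulr0 add0r exprS.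
apply: (@le_trans _ _ (\sum_(2 <= n < N.+2) n%:R ^- 2 * (13 / 20) ^+ size w)).
  apply: ler_sum_nat => -[//|n] _.
  by apply: ler_pM; rewrite ?expV_ge0 ?expV_anti ?IH.
rewrite -mulr_suml ler_wpM2r ?exprn_ge0//.
have := @sum_inv_sqr_le R N.+1; rewrite big_ltn// expr1n; lra.
Qed.

(** For m >= 2, m^-a is at most (4 / 2^a) m^-2, and with P for [prodstar] the
    sum of m^-2 P_m over 2 <= m <= n telescopes to P_n - 1 <= 1. *)
Lemma tsum_cons_le {R : realType} a (v : seq nat) N :
  (2 <= a)%N -> all (leq 2) v ->
  tsum (a :: v) ones N.+1 <= 1 + 4 / 2 ^+ a * ge2_indic N.+1 :> R.
Proof.
move=> a2 v2; case: N => [|N]; first by rewrite tsum_at1 /ge2_indic/= mulr0 addr0.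
rewrite /= big_ltn// tsum_at1 expr1n invr1 mul1r lerD2l /ge2_indic/= mulr1.
have step n : n.+2%:R ^- a * tsum v ones n.+2 <=
    4 / 2 ^+ a * (n.+2%:R ^- 2 * prodstar n.+2) :> R.
  rewrite mulrA; apply: ler_pM; rewrite ?expV_ge0 ?tsum_ge0 ?tsum_le_prodstar//.
  (* Both sides carry the factor (n+2)^-2, leaving (n+2)^-(a-2) <= 2^-(a-2). *)
  have e : (2 + (a - 2))%N = a by lia.
  rewrite -[in n.+2%:R ^- _]e -[in 2 ^+ a]e !exprD.
  rewrite !invfM mulrC ler_wpM2r ?expV_ge0//.
  have q : 4 * (2^-1 / 2) = 1 :> R by field.
  rewrite mulrA q mul1r.
  by rewrite lef_pV2 ?posrE ?exprn_gt0// lerXn2r ?nnegrE// ler_nat.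
apply: (@le_trans _ _ (\sum_(2 <= n < N.+3) 4 / 2 ^+ a * (n%:R ^- 2 * prodstar n))).
  by apply: ler_sum_nat => -[|[|n]]// _.
rewrite -mulr_sumr ler_piMr ?divr_ge0 ?exprn_ge0//.
have := @sum_prodstar R N.+2; have := @prodstar_le2 R N.+2.
have p1 : prodstar 1 = 1 :> R by rewrite /prodstar mulr1 divff.
by rewrite big_ltn// expr1n invr1 p1 mulr1; lra.
Qed.

(** * Zeta-star values as limits of truncated sums *)

(** An enumeration of the r-tuples of [star_domain] bounded by N; these finite sets
    exhaust the domain, which identifies the unordered sum with the limit of
    [tsum]. *)
Fixpoint star_list (r N : nat) : seq (seq nat) :=
  if r is r'.+1 then [seq n :: s | n <- index_iota 1 N.+1, s <- star_list r' n]
  else [:: [::]].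

Lemma star_list_uniq r N : uniq (star_list r N).
Proof.
elim: r N => //= r IH N; apply: allpairs_uniq_dep => //; first exact: iota_uniq.
by move=> [n s] [m t] _ _ /= [-> ->].
Qed.

Lemma mem_star_list r N s :
  reflect (star_domain r s /\ all (geq N) s) (s \in star_list r N).
Proof.
apply: (iffP idP).
  elim: r N s => [|r IH] N s /=; first by rewrite inE => /eqP ->.
  move=> /allpairsPdep[n [t [+ /IH [[st so pos] bd] ->]]].
  rewrite mem_index_iota => /andP[n1 nN]; split; first split=> /=.
  - by rewrite st.
  - by rewrite path_sortedE ?bd// => x y z /= ? ?; lia.
  - by rewrite n1.
  - rewrite /= -ltnS nN; apply: sub_all bd => x /= xn; lia.
elim: r N s => [|r IH] N [|n s] /= [[]]//= [st] so /andP[n1 pos] /andP[nN bd].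
move: so; rewrite path_sortedE => [|x y z /= ? ?]; last lia.
move=> /andP[ns so].
apply/allpairsPdep; exists n, s; split=> //.
  by rewrite mem_index_iota n1.
by apply: IH; split.
Qed.

Definition star_term {R : realType} (k n : seq nat) : R :=
  \prod_(i < size k) (nth 0%N n i)%:R ^- nth 0%N k i.

Lemma sum_star_list {R : realType} (k : seq nat) N :
  \sum_(s <- star_list (size k) N) star_term k s = tsum k ones N :> R.
Proof.
elim: k N => [|a k IH] N /=; first by rewrite big_seq1 /star_term big_ord0.
rewrite big_allpairs_dep/=; apply: eq_bigr => n _.
rewrite -IH mulr_sumr; apply: eq_bigr => s _.
by rewrite /star_term big_ord_recl.
Qed.

Lemma star_term_ge0 {R : realType} (k n : seq nat) : 0 <= star_term k n :> R.
Proof. by apply: prodr_ge0 => i _; exact: expV_ge0. Qed.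

(** The truncated sums are the sums over the finite sets [star_list], and every
    finite subset of the domain is contained in one of those, so both families
    have the same supremum. *)
Lemma zeta_star_cvg {R : realType} (k : seq nat) : all (leq 2) k ->
  tsum k ones N @[N --> \oo] --> zeta_star R k.
Proof.
move=> k2; set L := limn (tsum k ones : nat -> R).
have cv : cvgn (tsum k ones : nat -> R).
  apply: nondecreasing_is_cvgn; first exact: tsum_nondecreasing.
  by exists 2 => _ [N _ <-]; exact: tsum_le2.
have leL N : tsum k ones N <= L.
  by apply: nondecreasing_cvgn_le => //; exact: tsum_nondecreasing.
suff -> : zeta_star R k = L by [].
rewrite /zeta_star; set S := esum _ _.
have SL : (S <= L%:E)%E.
  apply: ge_ereal_sup => _ [X [finX XS] <-].
  have [N XN] : exists N, X `<=` [set` star_list (size k) N].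
    have /finite_seqP[t Xt] := finX.
    (* Bound all entries of all tuples of X at once. *)
    exists (\max_(s <- t) \max_(n <- s) n) => s Xs.
    apply/mem_star_list; split; first exact: XS.
    have : s \in t by rewrite Xt in Xs.
    move=> st; apply/allP => n ns /=.
    by apply: (bigmaxn_sup_seq s) => //; exact: (bigmaxn_sup_seq n).
  apply: (@le_trans _ _ (\sum_(s \in [set` star_list (size k) N]) (star_term k s)%:E)%E).
    apply: lee_fsum_nneg_subset => //; first exact: finite_seq.
      by move=> s; rewrite !inE => /XN.
    by move=> s _; rewrite lee_fin star_term_ge0.
  by rewrite -fsbig_seq ?star_list_uniq// sumEFin sum_star_list lee_fin.
have geS N : ((tsum k ones N)%:E <= S)%E.
  apply: esum_ge; exists [set` star_list (size k) N].
    by split; [exact: finite_seq|move=> s /mem_star_list[]].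
  by rewrite -fsbig_seq ?star_list_uniq// sumEFin sum_star_list.
have Sfin : S \is a fin_num.
  rewrite ge0_fin_numE; first exact: le_lt_trans SL (ltry _).
  by apply: le_trans (geS 0%N); rewrite lee_fin tsum_ge0.
apply/eqP; rewrite eq_le -lee_fin fineK// SL/=.
apply: limr_le => //; apply: nearW => N.
by rewrite -lee_fin fineK.
Qed.

Lemma zeta_star_le {R : realType} (k : seq nat) (c : R) : all (leq 2) k ->
  (forall N, tsum k ones N.+1 <= c) -> zeta_star R k <= c.
Proof.
move=> k2 kc; have /cvg_lim <-// := @zeta_star_cvg R k k2.
apply: limr_le; first by apply: cvgP; exact: zeta_star_cvg.
by apply: nearW => N; apply: le_trans (kc N); exact: tsum_nondecreasing.
Qed.

Lemma tsum_le_zeta_star {R : realType} (k : seq nat) N : all (leq 2) k ->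
  tsum k ones N <= zeta_star R k.
Proof.
move=> k2; have /cvg_lim <-// := @zeta_star_cvg R k k2.
apply: nondecreasing_cvgn_le; first exact: tsum_nondecreasing.
by apply: cvgP; exact: zeta_star_cvg.
Qed.

Lemma zeta_star_nil {R : realType} : zeta_star R [::] = 1.
Proof.
apply/eqP; rewrite eq_le zeta_star_le//=.
exact: (@tsum_le_zeta_star R [::] 0%N).
Qed.

Lemma zeta_star_le2 {R : realType} (k : seq nat) : all (leq 2) k ->
  zeta_star R k <= 2.
Proof. by move=> k2; apply: zeta_star_le => // N; exact: tsum_le2. Qed.

Lemma zeta_star_antitone {R : realType} (k l : seq nat) :
  all (leq 2) k -> all (leq 2) l -> all2 leq l k -> zeta_star R k <= zeta_star R l.
Proof.
move=> k2 l2 lk; apply: zeta_star_le => // N.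
apply: le_trans (tsum_le_zeta_star l N.+1 l2).
exact: tsum_antitone.
Qed.

Lemma tsum_cat_ge {R : realType} (w v : seq nat) N :
  tsum w ones N.+1 <= tsum (w ++ v) ones N.+1 :> R.
Proof.
rewrite tsum_cat; apply: tsum_le => n.
apply: (@le_trans _ _ (tsum v ones 1)); first by rewrite tsum_at1.
exact: tsum_nondecreasing.
Qed.

Lemma zeta_star_cat_ge {R : realType} (w v : seq nat) : all (leq 2) (w ++ v) ->
  zeta_star R w <= zeta_star R (w ++ v).
Proof.
move=> wv2; have := wv2; rewrite all_cat => /andP[w2 _].
apply: zeta_star_le => // N.
apply: le_trans (tsum_le_zeta_star _ N.+1 wv2).
exact: tsum_cat_ge.
Qed.

(** The tail contributes at most 1 + (4 / 2^a) 1_{n >= 2} as a function of the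
    last variable of w, and by linearity the correction is the sum over w of that
    indicator. *)
Lemma zeta_star_cat_le {R : realType} (w : seq nat) a (v : seq nat) :
  all (leq 2) (w ++ a :: v) ->
  zeta_star R (w ++ a :: v) <= zeta_star R w + (13 / 20) ^+ size w * (4 / 2 ^+ a).
Proof.
move=> wv2; have := wv2; rewrite all_cat => /andP[w2 /= /andP[a2 v2]].
apply: zeta_star_le => // N; rewrite tsum_cat.
apply: (@le_trans _ _ (tsum w (fun n => 1 + 4 / 2 ^+ a * ge2_indic n) N.+1)).
  by apply: tsum_le => n; exact: tsum_cons_le.
rewrite tsumD tsumZ lerD ?tsum_le_zeta_star// mulrC ler_wpM2r//.
  exact: tsum_ge2_indic_le.
Qed.

(** * Values of infinite sequences *)

Lemma mkseq_cat (k : nat -> nat) r m :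
  mkseq k (r + m.+1) = mkseq k r ++ k r :: mkseq (fun i => k (r.+1 + i)%N) m.
Proof.
rewrite /mkseq iotaD map_cat add0n /=; congr (_ ++ _ :: _).
by rewrite -[in LHS](addn0 r.+1) iotaDl -map_comp.
Qed.

Lemma all_mkseq (p : nat) (k : nat -> nat) r :
  (forall i, p <= k i)%N -> all (leq p) (mkseq k r).
Proof. by move=> kp; apply/allP => _ /mapP[i _ ->]. Qed.

Lemma zeta_star_mkseq_nondecreasing {R : realType} (k : nat -> nat) :
  (forall i, 2 <= k i)%N ->
  {homo (fun r => zeta_star R (mkseq k r)) : n m / (n <= m)%N >-> n <= m}.
Proof.
move=> k2; apply/nondecreasing_seqP => r; rewrite mkseqS -cats1.
by apply: zeta_star_cat_ge; rewrite cats1 -mkseqS all_mkseq.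
Qed.

Lemma eta_cvg {R : realType} (k : nat -> nat) : (forall i, 2 <= k i)%N ->
  zeta_star R (mkseq k r) @[r --> \oo] --> eta R k.
Proof.
move=> k2; apply: nondecreasing_is_cvgn; first exact: zeta_star_mkseq_nondecreasing.
by exists 2 => _ [N _ <-]; rewrite zeta_star_le2 ?all_mkseq.
Qed.

Lemma zeta_star_le_eta {R : realType} (k : nat -> nat) r :
  (forall i, 2 <= k i)%N -> zeta_star R (mkseq k r) <= eta R k.
Proof.
move=> k2; apply: (nondecreasing_cvgn_le (@zeta_star_mkseq_nondecreasing R k k2)).
by apply: cvgP; exact: eta_cvg.
Qed.

Lemma eta_le {R : realType} (k : nat -> nat) (c : R) :
  (forall i, 2 <= k i)%N ->
  (forall r, zeta_star R (mkseq k r.+1) <= c) -> eta R k <= c.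
Proof.
move=> k2 kc; apply: limr_le; first by apply: cvgP; exact: eta_cvg.
apply: nearW => r; apply: le_trans (kc r).
exact: zeta_star_mkseq_nondecreasing.
Qed.

Lemma eta_le_zeta_star {R : realType} (k : nat -> nat) r :
  (forall i, 2 <= k i)%N ->
  eta R k <= zeta_star R (mkseq k r) + (13 / 20) ^+ r * (4 / 2 ^+ k r).
Proof.
move=> k2; apply: eta_le => // m.
apply: (@le_trans _ _ (zeta_star R (mkseq k (r + m.+1)))).
  by apply: zeta_star_mkseq_nondecreasing => //; lia.
have := all_mkseq _ _ (r + m.+1) k2; rewrite mkseq_cat => h.
by apply: le_trans (@zeta_star_cat_le R _ _ _ h) _; rewrite size_mkseq.
Qed.

Lemma eta_antitone {R : realType} (k l : nat -> nat) :
  (forall i, 2 <= l i)%N -> (forall i, l i <= k i)%N -> eta R k <= eta R l.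
Proof.
move=> l2 lk; have k2 i : (2 <= k i)%N by apply: leq_trans (lk i).
apply: eta_le => // r; apply: le_trans (@zeta_star_le_eta R _ r.+1 l2).
apply: zeta_star_antitone; rewrite ?all_mkseq//.
by rewrite all2E !size_mkseq eqxx andTb zip_map all_map; apply/allP => i _ /=.
Qed.

(** * The closure *)

Definition cylinder (R : realType) (p : nat) (w : seq nat) : set R :=
  [set eta R k | k in [set k | calT_ge p k /\ mkseq k (size w) = w]].

Lemma calT_geP (p : nat) (k : nat -> nat) : (2 <= p)%N ->
  calT_ge p k <-> (forall i, p <= k i)%N.
Proof.
move=> p2; split=> [[]//|kp]; split=> //.
have k2 i : (2 <= k i)%N by apply: leq_trans (kp i).
by split=> // [i|_]; [apply: ltnW|exists 1%N].
Qed.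

Lemma four_half_pow_le1 {R : realType} a : (2 <= a)%N -> 4 / 2 ^+ a <= 1 :> R.
Proof.
move=> a2; rewrite ler_pdivrMr ?exprn_gt0// mul1r.
by rewrite -natrX ler_nat (@leq_pexp2l 2 2).
Qed.

Lemma cylinder_near {R : realType} p (w : seq nat) (y : R) : (2 <= p)%N ->
  cylinder R p w y -> zeta_star R w <= y <= zeta_star R w + (13 / 20) ^+ size w.
Proof.
move=> p2 [k [/(calT_geP _ _ p2) kp kw] <-].
have k2 i : (2 <= k i)%N by apply: leq_trans (kp i).
have := @zeta_star_le_eta R k (size w) k2.
have := @eta_le_zeta_star R k (size w) k2; rewrite kw => h1 -> /=.
apply: le_trans h1 _; rewrite lerD2l ler_piMr ?exprn_ge0//.
exact: four_half_pow_le1.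
Qed.

(** Cylinders over long words have small diameter; along a branch they
    determine the point. *)
Lemma closure_cylinder_near {R : realType} p (w : seq nat) (y : R) : (2 <= p)%N ->
  closure (cylinder R p w) y ->
  zeta_star R w <= y <= zeta_star R w + (13 / 20) ^+ size w.
Proof.
move=> p2 wy; suff : y \in `[zeta_star R w, zeta_star R w + (13 / 20) ^+ size w].
  by rewrite in_itv.
apply: itv_closed; move: wy; apply: closure_subset => z /cylinder_near h.
by rewrite /= in_itv/= h.
Qed.

(** The children of w accumulate only at the value of w, since the bound tends to 0
    in a. *)
Lemma cylinder_rcons {R : realType} p w (y : R) : (2 <= p)%N ->
  cylinder R p w y -> exists2 a, cylinder R p (rcons w a) y &
    zeta_star R w <= y <= zeta_star R w + 4 / 2 ^+ a.
Proof.
move=> p2 [k [kp kw] <-]; exists (k (size w)).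
  by exists k => //; split; rewrite ?size_rcons ?mkseqS ?kw.
have k2 i : (2 <= k i)%N by apply: leq_trans (kp.2 i).
have := @zeta_star_le_eta R k (size w) k2.
have := @eta_le_zeta_star R k (size w) k2; rewrite kw => h1 -> /=.
apply: le_trans h1 _; rewrite lerD2l ler_piMl ?divr_ge0 ?exprn_ge0//.
by rewrite exprn_ile1//; lra.
Qed.

Lemma closure_bigcup_lt {T : topologicalType} (F : nat -> set T) m (x : T) :
  closure (\bigcup_(i < m) F i) x -> exists i, closure (F i) x.
Proof.
elim: m => [|m IH].
  by rewrite bigcup_mkord big_ord0 closure0.
rewrite bigcup_mkord big_ord_recr/= -bigcup_mkord closureU => -[|]; first exact: IH.
by exists m.
Qed.

Lemma pow_half_small {R : realType} (d : R) : 0 < d ->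
  exists m, forall a, (m <= a)%N -> 4 / 2 ^+ a < d.
Proof.
move=> d0.
have : geometric 4 (2^-1 : R) n @[n --> \oo] --> 0.
  by apply: cvg_geometric; rewrite ger0_norm ?invf_lt1 ?ltr1n.
move/cvgrPdist_lt => /(_ _ d0)[m _ h]; exists m => a ma.
have := h a ma; rewrite /= sub0r normrN exprVn ger0_norm//.
Qed.

(** If x is not the value of w, all but finitely many children stay away from x, and
    the closure of a finite union is the union of the closures. *)
Lemma closure_cylinder_rcons {R : realType} p w (x : R) : (2 <= p)%N ->
  closure (cylinder R p w) x -> x <> zeta_star R w ->
  exists a, closure (cylinder R p (rcons w a)) x.
Proof.
move=> p2 wx xw.
have /andP[wlex _] := closure_cylinder_near _ _ _ p2 wx.
have d0 : 0 < (x - zeta_star R w) / 2.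
  by rewrite divr_gt0// subr_gt0 lt_def wlex andbT; apply/eqP.
(* Half the distance from x to the value of w: children beyond m stay below
   the midpoint. *)
have [m hm] := pow_half_small _ d0.
have : closure ((\bigcup_(a < m) cylinder R p (rcons w a)) `|`
    [set y | y <= zeta_star R w + (x - zeta_star R w) / 2]) x.
  move: wx; apply: closure_subset => y /(cylinder_rcons _ _ _ p2)[a ya /andP[_ yle]].
  have [am|/hm ma] := ltnP a m; first by left; exists a.
  by right => /=; apply: le_trans yle _; rewrite lerD2l ltW.
rewrite closureU => -[/closure_bigcup_lt//|].
move=> /(@closed_le R) h.
have : x <= zeta_star R w + (x - zeta_star R w) / 2 := h.
lra.
Qed.

Lemma closure_cylinder_all {R : realType} p w (x : R) :
  closure (cylinder R p w) x -> all (leq p) w.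
Proof.
move=> /(_ setT filterT)[_ [[k [[_ kp] <-] _] _]].
exact: all_mkseq.
Qed.

(** Going down the tree never stops as x is no finite value, and the resulting
    sequence has value x because the cylinders shrink to a point. *)
Lemma closure_infinite_branch {R : realType} p (x : R) : (2 <= p)%N ->
  closure (cylinder R p [::]) x ->
  (forall w, all (leq p) w -> x <> zeta_star R w) -> (eta R @` calT_ge p) x.
Proof.
move=> p2 x0 xfin.
have next w : exists a, closure (cylinder R p w) x ->
    closure (cylinder R p (rcons w a)) x.
  have [wx|//] := pselect (closure (cylinder R p w) x); last by exists 0%N.
  have := closure_cylinder_rcons _ _ _ p2 wx (xfin _ (closure_cylinder_all _ _ _ wx)).
  by move=> [a ?]; exists a.
have [f hf] := choice next.
(* [next] picks a child for every word, so it can be iterated from the root. *)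
pose branch := fix branch n := if n is n'.+1 then rcons (branch n') (f (branch n'))
  else [::].
pose k n := f (branch n).
have kE n : mkseq k n = branch n by elim: n => // n IH; rewrite mkseqS IH.
have kx n : closure (cylinder R p (mkseq k n)) x.
  by elim: n => // n IH; rewrite mkseqS kE; apply: hf; rewrite -kE.
have kp i : (p <= k i)%N.
  have := closure_cylinder_all _ _ _ (kx i.+1).
  by rewrite mkseqS all_rcons => /andP[].
exists k; first exact/calT_geP.
apply/esym/(cvg_unique _ _ (eta_cvg k _)) => //; last first.
  by move=> i; exact: leq_trans (kp i).
apply: (@squeeze_cvgr _ _ _ _ (fun n => x - (13 / 20) ^+ n) (fun=> x)).
- apply: nearW => n; have /andP[h1 h2] := closure_cylinder_near _ _ _ p2 (kx n).
  by rewrite h1 andbT lerBlDr; rewrite size_mkseq in h2.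
- rewrite -[X in _ --> X]subr0; apply: cvgB; first exact: cvg_cst.
  by apply: cvg_expr; rewrite ger0_norm; lra.
- exact: cvg_cst.
Qed.

(** Approximate w by the sequences w, a, a, a, ... with a large. *)
Lemma finite_value_closure {R : realType} p w : (2 <= p)%N -> all (leq p) w ->
  closure (eta R @` calT_ge p) (zeta_star R w).
Proof.
move=> p2 wp B /nbhs_ballP[e /= e0 eB].
have [m hm] := pow_half_small _ e0.
(* The default value of [nth] is the constant tail. *)
pose k := nth (maxn m p) w.
have kp i : (p <= k i)%N.
  rewrite /k; have [iw|iw] := ltnP i (size w).
    by move/allP: wp; apply; exact: mem_nth.
  by rewrite nth_default// leq_maxr.
have k2 i : (2 <= k i)%N by apply: leq_trans (kp i).
exists (eta R k); split; first by exists k => //; exact/calT_geP.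
apply: eB; rewrite /ball/=.
have := @zeta_star_le_eta R k (size w) k2.
have := @eta_le_zeta_star R k (size w) k2.
rewrite mkseq_nth {2}/k nth_default// => h1 h2.
rewrite ler0_norm ?subr_le0// opprB ltrBlDl.
apply: le_lt_trans h1 _; rewrite ltrD2l.
apply: le_lt_trans (hm _ (leq_maxl _ p)).
rewrite ler_piMl ?divr_ge0 ?exprn_ge0//.
by rewrite exprn_ile1//; lra.
Qed.

Lemma closure_eta_calT_ge {R : realType} p : (2 <= p)%N ->
  closure (eta R @` calT_ge p) =
  (eta R @` calT_ge p) `|` finite_values R p `|` [set 1].
Proof.
move=> p2; apply/seteqP; split=> [x xcl|x [[xeta|[w [_ wp] <-]]|->]].
- have [[w wp ->]|xfin] := pselect (exists2 w, all (leq p) w & x = zeta_star R w).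
    case: w wp => [|a w] wp; first by right; exact: zeta_star_nil.
    by left; right; exists (a :: w).
  left; left; apply: closure_infinite_branch => //.
    by move: xcl; apply: closure_subset => _ [k kp <-]; exists k.
  by move=> w wp xw; apply: xfin; exists w.
- exact: subset_closure.
- exact: finite_value_closure.
- by rewrite -(@zeta_star_nil R); exact: finite_value_closure.
Qed.

(** * The gap *)

(** A termwise comparison with some slack in the term of index 2; keeping that
    slack is what makes inequalities between limits strict. *)
Lemma ler_sum_gap2 {R : realType} (F G : nat -> R) (d : R) N :
  (forall n, F n.+1 <= G n.+1) -> F 2%N + d <= G 2%N ->
  \sum_(1 <= n < N.+3) F n + d <= \sum_(1 <= n < N.+3) G n.
Proof.
move=> FG FG2; rewrite !(@big_ltn _ _ _ 1)// !(@big_ltn _ _ _ 2)//.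
have : \sum_(3 <= n < N.+3) F n <= \sum_(3 <= n < N.+3) G n.
  by apply: ler_sum_nat => -[//|n] _.
have := FG 0%N; lra.
Qed.

(** The sequence (p+1, p, p, ...), which has the largest value among the sequences
    with entries at least p and first entry above p. *)
Definition succ_head (p i : nat) : nat := if i is 0%N then p.+1 else p.

Lemma mkseq_succ_head p r :
  mkseq (succ_head p) r.+1 = p.+1 :: mkseq (fun=> p) r.
Proof. exact: (mkseq_cat _ 0 r). Qed.

Lemma mkseq_cst (p r : nat) : mkseq (fun=> p) r.+1 = p :: mkseq (fun=> p) r.
Proof. exact: (mkseq_cat _ 0 r). Qed.

(** The n-th terms on the left add up to n^-p (1 + 1/n) [tsum w ones n], and
    [tsum w ones n] is at most 2n/(n+1); the constant c measures the slack at
    n = 2. *)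
Lemma tsum_add_gap {R : realType} p (w : seq nat) (c : R) N :
  all (leq 2) w -> 3 / 2 * tsum w ones 2 <= 2 - c ->
  tsum (p.+1 :: w) ones N.+2 + tsum (p :: w) ones N.+2 + 2 ^- p * c <=
  2 * tsum [:: p] ones N.+2.
Proof.
move=> w2 wc; rewrite /= -big_split/= mulr_sumr; apply: ler_sum_gap2 => [n|].
  rewrite exprS invfM mulr1 -mulrA mulrCA -mulrDr [leRHS]mulrC.
  rewrite ler_wpM2l ?expV_ge0// -[X in _ + X]mul1r -mulrDl.
  have := @tsum_le_prodstar R w n w2; rewrite /prodstar.
  move: (tsum _ _ _) => t; rewrite -(natr1 n.+1) => ht.
  have n0 : 0 < n.+1%:R :> R by rewrite ltr0n.
  have q0 : 0 <= n.+1%:R^-1 + 1 :> R by rewrite addr_ge0// invr_ge0.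
  apply: (le_trans (ler_wpM2l q0 ht)).
  rewrite le_eqVlt; apply/orP; left; apply/eqP; field.
  by rewrite !lt0r_neq0//; lra.
rewrite exprS invfM mulr1 -mulrA mulrCA -mulrDr -mulrDr [leRHS]mulrC.
rewrite ler_wpM2l ?expV_ge0//; lra.
Qed.

Lemma zeta_star_add_gap {R : realType} p (w : seq nat) (c : R) :
  (2 <= p)%N -> all (leq 2) w -> 3 / 2 * tsum w ones 2 <= 2 - c ->
  zeta_star R (p.+1 :: w) + zeta_star R (p :: w) + 2 ^- p * c <=
  2 * zeta_star R [:: p].
Proof.
move=> p2 w2 wc.
have a1 : all (leq 2) (p.+1 :: w) by rewrite /= w2 ltnW.
have a2 : all (leq 2) (p :: w) by rewrite /= w2 p2.
have a3 : all (leq 2) [:: p] by rewrite /= p2.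
apply: (@ler_cvg_to _ \oo _ _
  (fun N => tsum (p.+1 :: w) ones N + tsum (p :: w) ones N + 2 ^- p * c)
  (fun N => 2 * tsum [:: p] ones N)).
- by apply: cvgD (cvg_cst _); apply: cvgD; exact: zeta_star_cvg.
- by apply: cvgM; [exact: cvg_cst|exact: zeta_star_cvg].
- by exists 2%N => // -[|[|N]]// _; exact: tsum_add_gap.
Qed.

Lemma eta_add_gap {R : realType} p (c : R) :
  (2 <= p)%N ->
  (forall r, 3 / 2 * tsum (mkseq (fun=> p) r) ones 2 <= 2 - c) ->
  eta R (succ_head p) + eta R (fun=> p) + 2 ^- p * c <=
  2 * zeta_star R [:: p].
Proof.
move=> p2 pc.
have a1 : forall i, (2 <= succ_head p i)%N by case=> //; exact: ltnW.
apply: (@ler_cvg_to _ \oo _ _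
  (fun r => zeta_star R (mkseq (succ_head p) r) +
            zeta_star R (mkseq (fun=> p) r) + 2 ^- p * c)
  (fun=> 2 * zeta_star R [:: p])).
- by apply: cvgD (cvg_cst _); apply: cvgD; exact: eta_cvg.
- exact: cvg_cst.
exists 1%N => // -[|r]// _; rewrite mkseq_succ_head mkseq_cst.
by apply: zeta_star_add_gap; rewrite ?all_mkseq.
Qed.

Lemma eta_succ_head_add_le {R : realType} p : (2 <= p)%N ->
  eta R (succ_head p) + eta R (fun=> p) <= 2 * zeta_star R [:: p].
Proof.
move=> p2; have := @eta_add_gap R p 0 p2; rewrite mulr0 addr0; apply => r.
have := @tsum_le_prodstar R (mkseq (fun=> p) r) 1%N; rewrite all_mkseq//.
move=> /(_ isT); rewrite /prodstar; lra.
Qed.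

(** At n = 2 the infinite tail of 3's gives 1/(1 - 1/8) = 8/7, so there remains
    a slack 2 - 3/2 * 8/7 = 2/7. *)
Lemma eta_succ_head_add_lt {R : realType} p : (3 <= p)%N ->
  eta R (succ_head p) + eta R (fun=> p) < 2 * zeta_star R [:: p].
Proof.
move=> p3; have p0 : 0 < (2 : R) ^- p by rewrite invr_gt0 exprn_gt0.
suff H : eta R (succ_head p) + eta R (fun=> p) + 2 ^- p * (2 / 7) <=
    2 * zeta_star R [:: p] by lra.
apply: eta_add_gap; first exact: ltnW.
suff H r : tsum (mkseq (fun=> p) r) ones 2 <= 8 / 7 :> R by move=> r; have := H r; lra.
elim: r => [|r IH]; first by rewrite /=; lra.
rewrite mkseq_cst tsum_cons_recr tsum_at1.
have h : (2 : R) ^- p <= 1 / 8.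
  rewrite div1r lef_pV2 ?posrE ?exprn_gt0//.
  by rewrite -natrX ler_nat (@leq_pexp2l 2 3).
have := ler_pM (expV_ge0 2 p) (tsum_ge0 (mkseq (fun=> p) r) ones 2 (fun=> ler01)) h IH.
move: (tsum _ _ 2) => t /=; lra.
Qed.

(** Already the word (p, p) exceeds (p), by 4^-p from n_1 = n_2 = 2. *)
Lemma zeta_star_lt_eta {R : realType} p : (2 <= p)%N ->
  zeta_star R [:: p] < eta R (fun=> p).
Proof.
move=> p2; apply: lt_le_trans (@zeta_star_le_eta R (fun=> p) 2 (fun=> p2)).
have d0 : 0 < (2 : R) ^- p * 2 ^- p by rewrite mulr_gt0 ?invr_gt0 ?exprn_gt0.
rewrite -subr_gt0; apply: lt_le_trans d0 _; rewrite lerBrDl.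
have a2 : all (leq 2) [:: p; p] by rewrite /= p2.
have a3 : all (leq 2) [:: p] by rewrite /= p2.
apply: (@ler_cvg_to _ \oo _ _
  (fun N => tsum [:: p] ones N + 2 ^- p * 2 ^- p) (tsum [:: p; p] ones)).
- by apply: cvgD (cvg_cst _); exact: zeta_star_cvg.
- exact: zeta_star_cvg.
exists 2%N => // -[|[|N]]// _; rewrite /=; apply: ler_sum_gap2 => [n|].
  by rewrite ler_wpM2l ?expV_ge0// (@tsum_cat_ge R [::] [:: p]).
rewrite -mulrDr ler_wpM2l ?expV_ge0//.
by rewrite big_nat_recr//= big_nat1 expr1n; lra.
Qed.

(** Since [tsum w ones n] is at most 2n/(n+1), the n-th term is at most
    2/(n^2 (n+1)) = 2/n^2 - 2 (1/n - 1/(n+1)), which telescopes. *)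
Lemma tsum_3_le {R : realType} (w : seq nat) N : all (leq 2) w ->
  tsum (3%N :: w) ones N <= 2 * tsum [:: 2%N] ones N - 2 + 2 * N.+1%:R^-1 :> R.
Proof.
move=> w2; elim: N => [|N IH].
  by rewrite /= !big_geq// mulr0 invr1; lra.
rewrite !tsum_cons_recr/= mulr1.
have h : N.+1%:R ^- 3 * tsum w ones N.+1 <=
   2 * N.+1%:R ^- 2 - 2 * N.+1%:R^-1 + 2 * N.+2%:R^-1 :> R.
  apply: le_trans (ler_wpM2l (expV_ge0 _ _) (tsum_le_prodstar w N w2)) _.
  rewrite /prodstar -(natr1 N.+1) -(natr1 N).
  have : 0 <= N%:R :> R by []; move: N%:R => x x0.
  rewrite le_eqVlt; apply/orP; left; apply/eqP; field.
  by apply/andP; split; apply: lt0r_neq0; lra.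
move: IH h => /=; move: (N.+1%:R ^- 2) (N.+1%:R^-1) (N.+2%:R^-1) (N.+1%:R ^- 3 * _).
move: (\sum_(_ <= _ < _) _) (\sum_(_ <= _ < _) _) => s t a b c d; lra.
Qed.

Lemma eta_succ_head_2_le {R : realType} :
  eta R (succ_head 2) <= 2 * zeta_star R [:: 2%N] - 2.
Proof.
have a1 : forall i, (2 <= succ_head 2 i)%N by case.
apply: eta_le => // r; rewrite mkseq_succ_head.
have w2 : all (leq 2) (mkseq (fun=> 2%N) r) by exact: all_mkseq.
rewrite -[leRHS]addr0 -(mulr0 2).
have a2 : all (leq 2) [:: 2%N] by [].
have a3 : all (leq 2) (3%N :: mkseq (fun=> 2%N) r) by [].
apply: (@ler_cvg_to _ \oo _ _ (tsum (3%N :: mkseq (fun=> 2%N) r) ones)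
  (fun N => 2 * tsum [:: 2%N] ones N - 2 + 2 * N.+1%:R^-1)).
- exact: zeta_star_cvg.
- apply: cvgD; last by apply: cvgM; [exact: cvg_cst|exact: cvg_harmonic].
  by apply: cvgB (cvg_cst _); apply: cvgM; [exact: cvg_cst|exact: zeta_star_cvg].
- by apply: nearW => N; exact: tsum_3_le.
Qed.

Lemma zeta_star_2_le {R : realType} : zeta_star R [:: 2%N] <= 33 / 20.
Proof.
apply: zeta_star_le => // N; apply: le_trans (@sum_inv_sqr_le R N.+1).
by apply: ler_sum => n _; rewrite mulr1.
Qed.

(** The first entry is either p or at least p+1, and eta is antitone. *)
Lemma closure_eta_split {R : realType} p (x : R) : (2 <= p)%N ->
  closure (eta R @` calT_ge p) x ->
  1 <= x <= eta R (succ_head p) \/ zeta_star R [:: p] <= x <= eta R (fun=> p).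
Proof.
move=> p2 xK.
suff : closure (`[1, eta R (succ_head p)] `|` `[zeta_star R [:: p], eta R (fun=> p)]) x.
  by rewrite closureU => -[] /(@itv_closed _ R) /=; rewrite in_itv/=; [left|right].
move: xK; apply: closure_subset => _ [k /(calT_geP _ _ p2) kp <-] /=.
have k2 i : (2 <= k i)%N by apply: leq_trans (kp i).
rewrite !in_itv/=; have [k0|k0] := eqVneq (k 0%N) p.
  right; rewrite eta_antitone// andbT.
  by rewrite -[in [:: p]]k0; exact: (@zeta_star_le_eta R k 1).
left; apply/andP; split.
  by rewrite -(@zeta_star_nil R); exact: (@zeta_star_le_eta R k 0).
apply: eta_antitone => -[|i] //=; first exact: ltnW.
by rewrite ltn_neqAle eq_sym k0 kp.
Qed.

Lemma gap_not_closed_interval {R : realType} (S : set R) (u v : R) :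
  u < v -> S u -> S v -> (forall x, S x -> x <= u \/ v <= x) ->
  ~ is_closed_interval S.
Proof.
move=> uv Su Sv gap [a [b Sab]].
have : S ((u + v) / 2).
  move: Su Sv; rewrite Sab /= !in_itv/= => /andP[? ?] /andP[? ?].
  by apply/andP; split; lra.
by case/gap => ?; lra.
Qed.

Theorem theorem1p2 (R : realType) (p : nat) (hp : (2 <= p)%N) :
  let K : set R := closure (eta R @` calT_ge p) in
  [/\ K = (eta R @` calT_ge p) `|` finite_values R p `|` [set 1],
      ~ is_closed_interval (sumset K K) &
      ~ is_closed_interval (prodset K K)].
Proof.
move=> K; have KE : K = _ := @closure_eta_calT_ge R p hp.
set A := eta R (succ_head p); set B := zeta_star R [:: p].
set M := eta R (fun=> p).
have K1 : K 1 by rewrite KE; right.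
have KB : K B by apply: finite_value_closure => //=; rewrite leqnn.
have KA : K A.
  apply: subset_closure; exists (succ_head p) => //.
  by apply/(calT_geP _ _ hp) => -[|i] /=.
have KM : K M.
  by apply: subset_closure; exists (fun=> p) => //; exact/(calT_geP _ _ hp).
have A1 : 1 <= A.
  rewrite -(@zeta_star_nil R); apply: (@zeta_star_le_eta R (succ_head p) 0).
  by case=> [|i] //=; exact: ltnW.
have AMB : A + M <= 2 * B by exact: eta_succ_head_add_le.
have BM : B < M by exact: zeta_star_lt_eta.
have K_split x : K x -> 1 <= x <= A \/ B <= x <= M by exact: closure_eta_split.
split=> //.
- have [p2|p3] := eqVneq p 2%N.
    have A2 : A <= 2 * B - 2 by rewrite /A /B p2; exact: eta_succ_head_2_le.
    have B2 : B <= 33 / 20 by rewrite /B p2; exact: zeta_star_2_le.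
    apply: (@gap_not_closed_interval _ _ (A + A) (1 + B)); first by lra.
    + by exists A => //; exists A.
    + by exists 1 => //; exists B.
    + move=> _ [x /K_split hx [y /K_split hy <-]].
      by case: hx => /andP[? ?]; case: hy => /andP[? ?]; [left|right|right|right]; lra.
  have {}AMB : A + M < 2 * B by apply: eta_succ_head_add_lt; lia.
  apply: (@gap_not_closed_interval _ _ (A + M) (B + B)); first by lra.
  + by exists A => //; exists M.
  + by exists B => //; exists B.
  + move=> _ [x /K_split hx [y /K_split hy <-]].
    by case: hx => /andP[? ?]; case: hy => /andP[? ?]; [left|left|left|right]; lra.
- apply: (@gap_not_closed_interval _ _ (A * M) (B * B)); first by nra.
  + by exists A => //; exists M.
  + by exists B => //; exists B.
  + move=> _ [x /K_split hx [y /K_split hy <-]].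
    case: hx => /andP[? ?]; case: hy => /andP[? ?].
    - by left; apply: ler_pM; lra.
    - by left; apply: ler_pM; lra.
    - by left; rewrite [A * M]mulrC; apply: ler_pM; lra.
    - by right; apply: ler_pM; lra.
Qed.
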